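(* Let $f$ be a $k$-homogeneous $n$-variable Boolean function and let $U$ be a $k$-dimensional linear subspace of $\mathbb{F}_2^n$. Then $U\in N_k(f)$ if and only if $U^\perp\in N_{n-k}(\overline{f})$.
   Context: A Boolean function in algebraic normal form (ANF) is a sum $f=m_1+\dots+m_t$ of distinct monomials $x_I=\prod_{i\in I}x_i$, $I\subseteq[n]$; $f$ is $k$-homogeneous if all monomials have degree $k$. The complement of $x_I$ is $\overline{x_I}=x_{[n]\setminus I}$, and $\overline{f}=\overline{m_1}+\dots+\overline{m_t}$. For a Boolean function $g$ and $j\in\{0,\dots,n\}$, $N_j(g)$ is the set of $j$-dimensional linear subspaces $V$ of $\mathbb{F}_2^n$ with $\sum_{x\in V}g(x)\neq0$. $U^\perp$ is the orthogonal complement of $U$ with respect to the standard dot product. *)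

(* Defs.v *)
From HB Require Import structures.
From mathcomp Require Import all_boot all_order all_algebra.
Set Implicit Arguments.
Unset Strict Implicit.
Unset Printing Implicit Defensive.
Import GRing.Theory.
Local Open Scope ring_scope.

Definition monomial (n : nat) (I : {set 'I_n}) (x : 'rV['F_2]_n) : 'F_2 :=
  \prod_(i in I) x 0 i.

(* An algebraic normal form is the set of its (distinct) monomials x_I, each
   given by its index set I. By anf_fun_bij below every Boolean function is the
   value of exactly one algebraic normal form. *)
Definition anf (n : nat) : Type := {set {set 'I_n}}.

Definition anf_fun (n : nat) (f : anf n) : {ffun 'rV['F_2]_n -> 'F_2} :=
  [ffun x => \sum_(I in f) monomial I x].

Definition homogeneous (n k : nat) (f : anf n) : Prop :=
  forall I : {set 'I_n}, I \in f -> #|I| = k.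

Definition anf_compl (n : nat) (f : anf n) : anf n := [set ~: I | I in f].

Definition Nsub (n j : nat) (g : {ffun 'rV['F_2]_n -> 'F_2}) :
    pred {vspace 'rV['F_2]_n} :=
  [pred V : {vspace 'rV['F_2]_n} | (\dim V == j) && (\sum_(x in V) g x != 0)].

Definition dot (n : nat) (u v : 'rV['F_2]_n) : 'F_2 := \sum_i u 0 i * v 0 i.

Fact dot_is_bilinear (n : nat) :
  bilinear_for
    (GRing.Scale.Law.clone _ _ ( *%R ) _)
    (GRing.Scale.Law.clone _ _ (@idfun 'F_2 \; *%R ) _)
    (@dot n).
Proof.
split=> [v|u] a x y /=; rewrite /dot mulr_sumr -big_split /=.
  by apply: eq_bigr => i _; rewrite !mxE mulrDl mulrA.
by apply: eq_bigr => i _; rewrite !mxE mulrDr mulrCA.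
Qed.

HB.instance Definition _ (n : nat) :=
  bilinear_isBilinear.Build 'F_2 _ _ _
    (GRing.Scale.Law.clone _ _ ( *%R ) _)
    (GRing.Scale.Law.clone _ _ (@idfun 'F_2 \; *%R ) _)
    (@dot n) (@dot_is_bilinear n).

Fact dot_is_symmetric (n : nat) (u v : 'rV['F_2]_n) :
  dot u v = (-1) ^+ false * idfun (dot v u).
Proof. by rewrite mul1r; apply: eq_bigr => i _; rewrite mulrC. Qed.

HB.instance Definition _ (n : nat) :=
  isHermitianSesquilinear.Build 'F_2 'rV['F_2]_n false idfun (@dot n)
    (@dot_is_symmetric n).

Definition perp (n : nat) (U : {vspace 'rV['F_2]_n}) : {vspace 'rV['F_2]_n} :=
  orthov (@dot n : {symmetric 'rV['F_2]_n}) U.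

Lemma perpP (n : nat) (U : {vspace 'rV['F_2]_n}) (v : 'rV['F_2]_n) :
  reflect (forall u, u \in U -> dot v u = 0) (v \in perp U).
Proof. exact: mem_orthovP. Qed.

Lemma anf_fun_inj (n : nat) : injective (@anf_fun n).
Proof.
move=> f g fg; apply/setP => J.
have [m] := ubnP #|J|; elim: m J => // m IH J; rewrite ltnS => leJ.
pose x : 'rV['F_2]_n := \row_i (i \in J)%:R.
have monE (I : {set 'I_n}) : monomial I x = (I \subset J)%:R.
  rewrite /monomial; case: (boolP (I \subset J)) => [sIJ|/subsetPn [i iI iJ]].
    by rewrite big1 // => i iI; rewrite mxE (subsetP sIJ).
  by rewrite (bigD1 i) //= mxE (negbTE iJ) mul0r.
have evE (h : anf n) : anf_fun h x =
    (J \in h)%:R + \sum_(I : {set 'I_n} | I \proper J) (I \in h)%:R.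
  rewrite ffunE big_mkcond (bigD1 J) //= monE subxx; congr (_ + _).
    by case: (J \in h).
  rewrite big_mkcond [RHS]big_mkcond; apply: eq_bigr => I _.
  rewrite monE properEneq; case: (I != J); case: (I \subset J);
    by case: (I \in h).
have := congr1 (fun F : {ffun 'rV['F_2]_n -> 'F_2} => F x) fg.
rewrite !evE (eq_bigr (fun I : {set 'I_n} => (I \in g)%:R)).
  by move/addIr; case: (J \in f); case: (J \in g) => // /eqP.
by move=> I /proper_card ltIJ; rewrite IH // (leq_trans ltIJ).
Qed.

Lemma anf_fun_bij (n : nat) : bijective (@anf_fun n).
Proof.
have cardS (T : finType) : #|{set T}| = (2 ^ #|T|)%N.
  by rewrite -[LHS]cardsT -powersetT card_powerset cardsT.
apply: inj_card_bij (@anf_fun_inj n) _.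
by rewrite card_ffun card_mx card_Fp // mul1n /anf !cardS card_ord.
Qed.

(* Main.v *)
Require Import Defs.
From mathcomp Require Import all_boot all_order all_algebra zify.

(** For a monomial [x_I] and a subspace [U] of dimension [#|I|], the sum of
    [x_I] over [U] is 1 exactly when [U] meets the coordinate subspace
    [Z_I = {x | x_i = 0 for i in I}] trivially: a nonzero [z] in the intersection
    gives a fixed-point-free translation of [U] preserving [x_I], while
    otherwise [U] and [Z_I] are complementary and a single vector of [U] has all
    its [I]-coordinates equal to 1. As [Z_(~: I)] is the orthogonal of [Z_I],
    complementarity of [U] and [Z_I] is the same as complementarity of [U^perp]
    and [Z_(~: I)], so the two sums agree monomial by monomial. *)

Set Implicit Arguments.
Unset Strict Implicit.
Unset Printing Implicit Defensive.
Import GRing.Theory.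

Local Open Scope ring_scope.

Lemma dot_delta n (v : 'rV['F_2]_n) i : dot v (delta_mx 0 i) = v 0 i.
Proof.
rewrite /dot (bigD1 i) //= mxE !eqxx mulr1 big1 ?addr0 // => j /negPf ji.
by rewrite mxE ji andbF mulr0.
Qed.

Lemma dotC n (u v : 'rV['F_2]_n) : dot u v = dot v u.
Proof. by apply: eq_bigr => i _; rewrite mulrC. Qed.

Lemma perpD n (U V : {vspace 'rV['F_2]_n}) :
  perp (U + V)%VS = (perp U :&: perp V)%VS.
Proof.
apply/vspaceP => v; rewrite memv_cap; apply/perpP/andP => [vUV | [/perpP vU /perpP vV]].
  by split; apply/perpP => u uU; apply: vUV; apply: subvP u uU;
     rewrite ?addvSl ?addvSr.
by move=> _ /memv_addP [u uU [w wV ->]]; rewrite linearDr /= vU // vV // addr0.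
Qed.

Lemma perp0 n : perp (0%VS : {vspace 'rV['F_2]_n}) = fullv.
Proof. exact: orthov0. Qed.

Lemma perpf n : perp (fullv : {vspace 'rV['F_2]_n}) = 0%VS.
Proof.
apply/eqP; rewrite -subv0; apply/subvP => v /perpP v0; rewrite memv0.
apply/eqP/rowP => i; rewrite mxE -dot_delta; apply: v0; exact: memvf.
Qed.

(** Each vector of [X] imposes one linear equation on [V], which lowers the dimension by at most
    one. *)
Lemma leq_dim_cap_perp_span n (V : {vspace 'rV['F_2]_n}) X :
  (\dim V <= \dim (V :&: perp <<X>>) + size X)%N.
Proof.
elim: X V => [|x X IH] V; first by rewrite span_nil perp0 capvf addn0.
rewrite span_cons perpD capvA /= addnS.
apply: leq_trans (leqSpred _) _; rewrite ltnS.
exact: leq_trans (leq_dim_orthov1 _ _ _) (IH _).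
Qed.

Lemma dim_rVf n : \dim (fullv : {vspace 'rV['F_2]_n}) = n.
Proof. by rewrite dimvf dim_matrix mul1r. Qed.

Lemma dim_perp n (U : {vspace 'rV['F_2]_n}) : (\dim (perp U) + \dim U = n)%N.
Proof.
apply/eqP; rewrite eqn_leq; apply/andP; split.
  (* Upper bound: a vector of [perp U] that is also orthogonal to a basis of a complement of [U] is
     orthogonal to everything, hence zero. *)
  have := leq_dim_cap_perp_span (perp U) (vbasis U^C).
  rewrite (span_basis (vbasisP _)) -perpD addv_complf perpf dimv0 add0n size_tuple.
  by rewrite dimv_compl dim_rVf leq_subRL ?(leq_trans (dimvS (subvf U))) ?dim_rVf // addnC.
have := leq_dim_cap_perp_span fullv (vbasis U).
by rewrite (span_basis (vbasisP _)) capfv size_tuple dim_rVf.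
Qed.

(** Encoding this space as an orthogonal of unit vectors lets [leq_dim_cap_perp_span] and [perpD]
    apply to it. *)
Definition coord_zero n (I : {set 'I_n}) : {vspace 'rV['F_2]_n} :=
  perp <<[seq delta_mx 0%R i | i <- enum I]>>.

Lemma coord_zeroP n (I : {set 'I_n}) (x : 'rV['F_2]_n) :
  reflect {in I, forall i, x 0 i = 0} (x \in coord_zero I).
Proof.
apply: (iffP (perpP _ _)) => [x0 i iI | x0 u uI].
  rewrite -dot_delta; apply: x0; apply: memv_span.
  by apply: map_f; rewrite mem_enum.
(* Symmetry of [dot] swaps the roles: only the generators of the span need to be tested against
   [x]. *)
have /subvP/(_ u uI)/perpP :
    (<<[seq delta_mx 0%R i | i <- enum I]>> <= perp <[x]>)%VS.
  apply/span_subvP => _ /mapP [i + ->]; rewrite mem_enum => iI.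
  apply/perpP => _ /vlineP [c ->].
  by rewrite linearZr_LR /= dotC dot_delta x0 //= mulr0.
by rewrite dotC; apply; exact: memv_line.
Qed.

Lemma coord_zero_capC n (I : {set 'I_n}) :
  (coord_zero I :&: coord_zero (~: I))%VS = 0%VS.
Proof.
apply/eqP; rewrite -subv0; apply/subvP => x.
rewrite memv_cap => /andP [/coord_zeroP xI /coord_zeroP xC].
rewrite memv0; apply/eqP/rowP => i; rewrite mxE.
by case: (boolP (i \in I)) => iI; [apply: xI | apply: xC; rewrite inE].
Qed.

(** Counting equations bounds the dimensions for [I] and [~: I] from below by [n - #|I|] and [#|I|].
    The two spaces meet trivially, so their dimensions add up to at most [n] and both bounds are
    equalities. *)
Lemma dim_coord_zero n (I : {set 'I_n}) : (\dim (coord_zero I) + #|I| = n)%N.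
Proof.
have geI J : (n <= \dim (@coord_zero n J) + #|J|)%N.
  have := leq_dim_cap_perp_span fullv [seq delta_mx 0 i | i <- enum J].
  by rewrite capfv size_map -cardE dim_rVf.
have := dimv_sum_cap (coord_zero I) (coord_zero (~: I)).
rewrite coord_zero_capC dimv0 addn0 => dimD.
have := dimvS (subvf (coord_zero I + coord_zero (~: I))); rewrite dim_rVf.
have := cardsC I; rewrite card_ord.
have := geI I; have := geI (~: I); lia.
Qed.

Lemma perp_coord_zero n (I : {set 'I_n}) :
  perp (coord_zero I) = coord_zero (~: I).
Proof.
apply/esym/eqP; rewrite eqEdim; apply/andP; split.
  apply/subvP => x /coord_zeroP xC; apply/perpP => u /coord_zeroP uI.
  rewrite /dot big1 // => i _; case: (boolP (i \in I)) => iI.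
    by rewrite uI ?mulr0.
  by rewrite xC ?mul0r // inE.
have := dim_perp (coord_zero I); have := dim_coord_zero I.
have := dim_coord_zero (~: I); have := cardsC I; rewrite card_ord; lia.
Qed.

Lemma addv_full_capv0 n (U V : {vspace 'rV['F_2]_n}) :
  (\dim U + \dim V = n)%N -> (U + V == fullv)%VS = (U :&: V == 0)%VS.
Proof.
move=> dimUV; rewrite eqEdim subvf dim_rVf -dimv_eq0 /=.
have := dimv_sum_cap U V; lia.
Qed.

Lemma perp_eq0 n (U : {vspace 'rV['F_2]_n}) : (perp U == 0)%VS = (U == fullv).
Proof.
rewrite -dimv_eq0 eqEdim subvf dim_rVf /=.
have := dim_perp U; lia.
Qed.

(** The left intersection is the orthogonal of [U + coord_zero I], so it vanishes exactly when that
    sum is the full space. *)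
Lemma capv_perp_coord_zero n (I : {set 'I_n}) (U : {vspace 'rV['F_2]_n}) :
  \dim U = #|I| ->
  (perp U :&: coord_zero (~: I) == 0)%VS = (U :&: coord_zero I == 0)%VS.
Proof.
move=> dimU; rewrite -perp_coord_zero -perpD perp_eq0 addv_full_capv0 //.
by rewrite dimU addnC dim_coord_zero.
Qed.

Lemma F2_neq0 (a : 'F_2) : a != 0 -> a = 1.
Proof. by case: a => [[|[|//]]] // lt _; apply: val_inj. Qed.

Lemma F2_addrr (a : 'F_2) : a + a = 0.
Proof. by case: a => [[|[|//]]] // lt; apply: val_inj. Qed.

Lemma monomialE n (I : {set 'I_n}) (x : 'rV['F_2]_n) :
  monomial I x = [forall i in I, x 0 i == 1]%:R.
Proof.
case: (boolP [forall i in I, _]) => [/forall_inP x1 | /forall_inPn [i iI xi]].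
  by rewrite /monomial big1 // => i /x1 /eqP.
rewrite /monomial (bigD1 i) //=; have [->|/F2_neq0 xi1] := eqVneq (x 0 i) 0.
  by rewrite mul0r.
by rewrite xi1 in xi.
Qed.

(** Translation by [z] flips a coordinate [i] with [z 0 i != 0], so it exchanges the two halves of
    [U] cut out by that coordinate. Their sums are equal and cancel in characteristic 2. *)
Lemma sum_translation_invariant n (U : {vspace 'rV['F_2]_n}) z
    (g : 'rV['F_2]_n -> 'F_2) :
  z \in U -> z != 0 -> (forall x, g (x + z) = g x) -> \sum_(x in U) g x = 0.
Proof.
move=> zU z0 gz.
have [i zi] : exists i, z 0 i != 0 by apply/rV0Pn.
rewrite (bigID (fun x : 'rV['F_2]_n => x 0 i == 0)) /=.
rewrite (reindex_inj (addIr z)) /= [X in X + _](_ : _ = 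
  \sum_(x in U | x 0 i != 0) g x) ?F2_addrr //.
apply: eq_big => [x | x _]; last exact: gz.
rewrite rpredDr // mxE (F2_neq0 zi).
have [->|/F2_neq0 ->] := eqVneq (x 0 i) 0; first by rewrite add0r.
by rewrite F2_addrr.
Qed.

Lemma sum_monomial n (I : {set 'I_n}) (U : {vspace 'rV['F_2]_n}) :
  \dim U = #|I| ->
  \sum_(x in U) monomial I x = (U :&: coord_zero I == 0)%VS%:R.
Proof.
move=> dimU; have [cap0 | ] := eqVneq (U :&: coord_zero I)%VS 0%VS.
  (* The [U]-component [u] of the all-ones vector agrees with it on [I]. *)
  have : const_mx 1 \in (U + coord_zero I)%VS.
    suff /eqP -> : (U + coord_zero I == fullv)%VS by apply: memvf.
    by rewrite addv_full_capv0 ?cap0 // dimU addnC dim_coord_zero.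
  case/memv_addP => u uU [w /coord_zeroP wI uw1].
  have u1 i : i \in I -> u 0 i = 1.
    by move=> iI; have := congr1 (fun x : 'rV_n => x 0 i) uw1; rewrite !mxE wI ?addr0.
  rewrite (bigD1 u) //= monomialE [X in X + _](_ : _ = 1); last first.
    by rewrite (_ : [forall i in I, _]) //; apply/forall_inP => i /u1 ->.
  (* Another such [x] would differ from [u] by an element of the trivial intersection. *)
  rewrite big1 ?addr0 // => x /andP [xU xu]; rewrite monomialE.
  case: (boolP [forall i in I, _]) => // /forall_inP x1.
  case/eqP: xu; apply/eqP; rewrite -subr_eq0 -memv0 -cap0 memv_cap rpredB //=.
  by apply/coord_zeroP => i iI; rewrite !mxE u1 // (eqP (x1 i iI)) subrr.
rewrite -vpick0; set z := vpick _ => z0.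
have : z \in (U :&: coord_zero I)%VS by apply: memv_pick.
rewrite memv_cap => /andP [zU /coord_zeroP zI].
apply: (sum_translation_invariant zU z0) => x.
by apply: eq_bigr => i iI; rewrite mxE zI ?addr0.
Qed.

Theorem theorem5p10 (n k : nat) (f : anf n) (U : {vspace 'rV['F_2]_n}) :
  homogeneous k f -> \dim U = k ->
  (U \in Nsub k (anf_fun f) <->
   perp U \in Nsub (n - k) (anf_fun (anf_compl f))).
Proof.
move=> homf dimU.
have dimP : \dim (perp U) = (n - k)%N by rewrite -dimU -[X in (X - _)%N](dim_perp U) addnK.
rewrite !inE dimU dimP !eqxx /=.
(* The two sums are equal in ['F_2], and this is proved monomial by monomial after exchanging the
   order of summation. Complementation is injective, so the monomials of [anf_compl f] are indexed
   by those of [f]. *)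
suff -> : \sum_(x in perp U) anf_fun (anf_compl f) x = \sum_(x in U) anf_fun f x by [].
under eq_bigr do rewrite ffunE; under [RHS]eq_bigr do rewrite ffunE.
rewrite exchange_big [RHS]exchange_big /= big_imset /=; last by move=> I J _ _; apply: setC_inj.
apply: eq_bigr => I /homf cardI.
have cardC : #|~: I| = (n - k)%N by rewrite -cardI -[n in (n - _)%N]card_ord -(cardsC I) addKn.
by rewrite !sum_monomial ?cardC ?cardI // capv_perp_coord_zero ?cardI.
Qed.
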